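(* For any $\kappa$ with $0<\kappa<1$, we have $$\liminf_{n\to\infty}\operatorname{diam}(\mathbb{S}^n\stackrel{\mathrm{Lip}_1}{\longrightarrow}\mathbb{R}^{n+1},1-\kappa)>0.$$
   Context: $\mathbb{S}^n$ is the unit sphere in $\mathbb{R}^{n+1}$, regarded as a metric measure space with the restriction of the Euclidean distance of $\mathbb{R}^{n+1}$ and with the volume measure $\mu_n$ normalized so that $\mu_n(\mathbb{S}^n)=1$. For a finite Borel measure $\nu$ on a metric space $Y$ with $m=\nu(Y)$ and $\kappa>0$, the partial diameter is $\operatorname{diam}(\nu,m-\kappa):=\inf\{\operatorname{diam} Y_0\mid Y_0\subseteq Y \text{ Borel},\ \nu(Y_0)\ge m-\kappa\}$. For a complete separable metric space $X$ with a finite Borel measure $\mu$ of total mass $m$, a metric space $Y$ and $\kappa>0$, the observable diameter is $\operatorname{diam}(X\stackrel{\mathrm{Lip}_1}{\longrightarrow}Y,m-\kappa):=\sup\{\operatorname{diam}(f_*(\mu),m-\kappa)\mid f:X\to Y \text{ is a 1-Lipschitz map}\}$. *)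

(* Defs.v *)
From HB Require Import structures.
From mathcomp Require Import all_boot all_order all_algebra.
From mathcomp Require Import all_classical all_reals all_analysis.
From mathcomp Require Import ring lra.

Set Implicit Arguments.
Unset Strict Implicit.
Unset Printing Implicit Defensive.

Import Order.TTheory GRing.Theory Num.Theory.
Import numFieldTopology.Exports.

Local Open Scope classical_set_scope.
Local Open Scope ring_scope.

(* The measurable types of the library are pointed. *)
#[short(type="pmetricType")]
HB.structure Definition PointedMetricSpace (R : numDomainType) :=
  {M of Metric R M & Pointed M}.

Definition borel_space (R : numDomainType) (X : pmetricType R) :=
  g_sigma_algebraType (@open X).

Section diameter.
Context {R : realType}.
Local Open Scope ereal_scope.

(* The maximum with 0 makes the diameter of the empty set 0 instead of -oo. *)
Definition diam {X : metricType R} (A : set X) : \bar R :=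
  maxe 0 (ereal_sup [set (mdist p.1 p.2)%:E | p in A `*` A]).

Definition lipschitz1 {X Y : metricType R} (f : X -> Y) : Prop :=
  forall x y, (mdist (f x) (f y) <= mdist x y)%R.

Definition partial_diam {Y : pmetricType R}
    (nu : set (borel_space Y) -> \bar R) (a : \bar R) : \bar R :=
  ereal_inf [set diam (Y0 : set Y) |
    Y0 in [set Y0 : set (borel_space Y) | measurable Y0 /\ a <= nu Y0]].

(* diam(X --Lip_1--> Y, m - kappa) where m = mu(X); the push-forward is a
   measure by [lipschitz1_measurable] below. *)
Definition observable_diam {X : pmetricType R}
    (mu : {finite_measure set (borel_space X) -> \bar R})
    (Y : pmetricType R) (kappa : R) : \bar R :=
  ereal_sup [set partial_diam
      (pushforward mu (f : borel_space X -> borel_space Y))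
      (mu [set: borel_space X] - kappa%:E) |
    f in [set f : X -> Y | lipschitz1 f]].

Lemma lipschitz1_measurable (X Y : pmetricType R) (f : X -> Y) :
  lipschitz1 f ->
  measurable_fun [set: borel_space X] (f : borel_space X -> borel_space Y).
Proof.
move=> fl; apply: (@measurability _ _ (borel_space X) (borel_space Y) setT f (@open Y)).
  by [].
move=> _ [U oU <-].
rewrite setTI; apply: sub_sigma_algebra.
move: oU; apply: open_comp => x _ B.
move=> /nbhs_ballP[e /= e0 eB]; apply/nbhs_ballP; exists e => //= y xy.
apply: eB; move: xy; rewrite !ballEmdist /=; exact: le_lt_trans.
Qed.

Lemma diam_ge0 (X : metricType R) (A : set X) : 0 <= diam A.
Proof. by rewrite /diam le_max lexx. Qed.

Lemma diam0 (X : metricType R) : diam (@set0 X) = 0.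
Proof. by rewrite /diam set0X image_set0 ereal_sup0 max_l// leNye. Qed.

Lemma le_diam (X : metricType R) (A B : set X) : A `<=` B -> diam A <= diam B.
Proof.
move=> AB; rewrite /diam ge_max le_max lexx/= le_max; apply/orP; right.
by apply: ereal_sup_le; apply: image_subset => -[x y] [/AB ? /AB ?].
Qed.

Lemma mdist_le_diam (X : metricType R) (A : set X) x y :
  A x -> A y -> (mdist x y)%:E <= diam A.
Proof.
move=> Ax Ay; rewrite /diam le_max; apply/orP; right.
by apply: ereal_sup_ubound; exists (x, y).
Qed.

End diameter.

Section hausdorff_definition.
Context {R : realType} (X : pmetricType R) (d : nat).
Local Open Scope ereal_scope.

(* For d = 0 a nonempty set counts 1, so that the measure counts points. *)
Definition hausdorff_gauge (U : set X) : \bar R :=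
  if U == set0 then 0 else diam U ^+ d.

Definition hausdorff_cover (delta : R) (A : set X) (U : (set X)^nat) : Prop :=
  (forall i, diam (U i) <= delta%:E) /\ A `<=` \bigcup_i U i.

Definition hausdorff_content (delta : R) (A : set X) : \bar R :=
  ereal_inf [set \sum_(i <oo) hausdorff_gauge (U i) |
             U in hausdorff_cover delta A].

Definition hausdorff (A : set X) : \bar R :=
  ereal_sup [set hausdorff_content delta A |
             delta in [set delta : R | (0 < delta)%R]].

End hausdorff_definition.

(* The sets of diameter at most delta form a semiring of sets, which makes
   [hausdorff_content] the outer measure [mu_ext] of the gauge. *)
Definition small_sets (R : realType) (X : pmetricType R) (delta : {posnum R}) :
  Type := X.

Section small_sets_semiring.
Context {R : realType} (X : pmetricType R) (delta : {posnum R}).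

Let small : set (set (small_sets X delta)) :=
  [set U : set X | (diam U <= delta%:num%:E)%E].

Let small0 : small set0.
Proof. by rewrite /small/= diam0 lee_fin. Qed.

Let smallI : setI_closed small.
Proof.
by move=> A B sA sB; apply: le_trans sA; apply: le_diam => x [].
Qed.

Let smallD : semi_setD_closed small.
Proof.
move=> A B sA sB; exists [set A `\` B]; split.
- exact: finite_set1.
- by move=> C ->; apply: le_trans sA; apply: le_diam => x [].
- by rewrite bigcup_set1.
- by move=> C D -> ->.
Qed.

HB.instance Definition _ := Pointed.on (small_sets X delta).
HB.instance Definition _ := isSemiRingOfSets.Build default_measure_display
  (small_sets X delta) small0 smallI smallD.

End small_sets_semiring.

Section hausdorff_outer.
Context {R : realType} (X : pmetricType R) (d : nat).
Local Open Scope ereal_scope.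
Local Notation gauge := (hausdorff_gauge d).
Local Notation content := (@hausdorff_content R X d).
Local Notation H := (@hausdorff R X d).

Lemma hausdorff_gauge0 : gauge (@set0 X) = 0.
Proof. by rewrite /hausdorff_gauge eqxx. Qed.

Lemma hausdorff_gauge_ge0 (U : set X) : 0 <= gauge U.
Proof.
by rewrite /hausdorff_gauge; case: ifP => // _; rewrite expe_ge0// diam_ge0.
Qed.

Lemma le_hausdorff_gauge (U V : set X) : U `<=` V -> gauge U <= gauge V.
Proof.
move=> UV; rewrite /hausdorff_gauge; case: ifPn => [_|U0].
  exact: hausdorff_gauge_ge0.
case: ifPn => [/eqP V0|_].
  by move: U0; rewrite (_ : U = set0) ?eqxx// -subset0 -V0.
elim: d => [//|n ih]; rewrite !expeS lee_pmul ?diam_ge0 ?expe_ge0 ?diam_ge0//.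
exact: le_diam.
Qed.

Let contentE (delta : {posnum R}) :
  content delta%:num = @mu_ext _ (small_sets X delta) R gauge.
Proof. by []. Qed.

Let content_ge0 (delta : {posnum R}) A : 0 <= content delta%:num A.
Proof. by rewrite contentE; apply: mu_ext_ge0 => U; exact: hausdorff_gauge_ge0. Qed.

Lemma hausdorff_content_le (delta delta' : R) A : (delta <= delta')%R ->
  content delta' A <= content delta A.
Proof.
move=> dd; apply: ereal_inf_le_tmp; apply: image_subset => U [Ud AU].
by split=> // i; rewrite (le_trans (Ud i))// lee_fin.
Qed.

Lemma hausdorff_content_le_hausdorff (delta : R) A : (0 < delta)%R ->
  content delta A <= H A.
Proof. by move=> d0; apply: ereal_sup_ubound; exists delta. Qed.

Lemma hausdorff0 : H set0 = 0.
Proof.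
apply/eqP; rewrite eq_le; apply/andP; split.
  apply: ge_ereal_sup => _ [delta /= d0 <-].
  rewrite (contentE (PosNum d0)) mu_ext0 ?hausdorff_gauge0//.
  by move=> U; exact: hausdorff_gauge_ge0.
apply: le_trans (hausdorff_content_le_hausdorff _ ltr01).
exact: (content_ge0 (PosNum ltr01)).
Qed.

Lemma hausdorff_ge0 A : 0 <= H A.
Proof.
apply: le_trans (hausdorff_content_le_hausdorff _ ltr01).
exact: (content_ge0 (PosNum ltr01)).
Qed.

Lemma le_hausdorff : {homo H : A B / A `<=` B >-> A <= B}.
Proof.
move=> A B AB; apply: ge_ereal_sup => _ [delta /= d0 <-].
apply: le_trans (hausdorff_content_le_hausdorff _ d0).
by rewrite (contentE (PosNum d0)); apply: le_mu_ext.
Qed.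

Lemma hausdorff_sigma_subadditive : sigma_subadditive H.
Proof.
move=> F; apply: ge_ereal_sup => _ [delta /= d0 <-].
rewrite (contentE (PosNum d0)).
apply: le_trans (mu_ext_sigma_subadditive _ _) _.
  exact: hausdorff_gauge_ge0.
apply: lee_nneseries => [i _ _|i _]; first exact: (content_ge0 (PosNum d0)).
exact: (hausdorff_content_le_hausdorff _ d0).
Qed.

HB.instance Definition _ := isOuterMeasure.Build R X H
  hausdorff0 hausdorff_ge0 le_hausdorff hausdorff_sigma_subadditive.

Lemma hausdorff_separated (A B : set X) (e : R) : (0 < e)%R ->
  (forall x y, A x -> B y -> (e <= mdist x y)%R) ->
  H A + H B <= H (A `|` B).
Proof.
move=> e0 sepAB.
suff key (d1 d2 : R) : (0 < d1)%R -> (0 < d2)%R ->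
    content d1 A + content d2 B <= H (A `|` B).
  have [->|/negP] := eqVneq (H (A `|` B)) +oo; first by rewrite leey.
  move=> /negP ABoo.
  have ABf : H (A `|` B) \is a fin_num.
    by rewrite ge0_fin_numE ?hausdorff_ge0// ltey.
  have Bf : H B \is a fin_num.
    rewrite ge0_fin_numE ?hausdorff_ge0//; apply: le_lt_trans (_ : _ <= H (A `|` B)) _.
      by apply: le_hausdorff => x; right.
    by rewrite ltey.
  rewrite -leeBrDr//; apply: ge_ereal_sup => _ [d1 /= d10 <-].
  have cf : content d1 A \is a fin_num.
    rewrite ge0_fin_numE ?(content_ge0 (PosNum d10))//.
    apply: (@le_lt_trans _ _ (H (A `|` B))); last by rewrite ltey.
    apply: le_trans (hausdorff_content_le_hausdorff _ d10) _.
    by apply: le_hausdorff => x; left.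
  rewrite leeBrDr// addeC -leeBrDr//; apply: ge_ereal_sup => _ [d2 /= d20 <-].
  by rewrite leeBrDr// addeC; exact: key.
move=> d10 d20; pose dl : R := Num.min (Num.min d1 d2) (e / 2)%R.
have dl0 : (0 < dl)%R by rewrite /dl !lt_min d10 d20 divr_gt0.
have le1 : (dl <= d1)%R by rewrite /dl !ge_min lexx.
have le2 : (dl <= d2)%R by rewrite /dl !ge_min lexx orbT.
have lte : (dl < e)%R.
  by rewrite /dl gt_min ltr_pdivrMr// ltr_pMr// ltr1n orbT.
apply: le_trans (hausdorff_content_le_hausdorff _ dl0).
apply: le_trans (leeD (hausdorff_content_le _ le1) (hausdorff_content_le _ le2)) _.
apply: le_ereal_inf_tmp => _ [U [Ud ABU] <-].
apply: (@le_trans _ _ (\sum_(i <oo) (gauge (U i `&` A) + gauge (U i `&` B)))).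
  rewrite nneseriesD; do ?by move=> *; exact: hausdorff_gauge_ge0.
  apply: leeD; apply: ereal_inf_lbound.
    exists (fun i => U i `&` A) => //; split.
      by move=> i; apply: le_trans (Ud i); apply: le_diam => x [].
    move=> x Ax; have [i _ Uix] : (\bigcup_i U i) x by apply: ABU; left.
    by exists i.
  exists (fun i => U i `&` B) => //; split.
    by move=> i; apply: le_trans (Ud i); apply: le_diam => x [].
  move=> x Bx; have [i _ Uix] : (\bigcup_i U i) x by apply: ABU; right.
  by exists i.
apply: lee_nneseries => [i _ _|i _].
  by rewrite adde_ge0// hausdorff_gauge_ge0.
have [UA0|/set0P[x [Ux Ax]]] := eqVneq (U i `&` A) set0.
  by rewrite UA0 hausdorff_gauge0 add0e; apply: le_hausdorff_gauge => x [].
have [UB0|/set0P[y [Uy By]]] := eqVneq (U i `&` B) set0.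
  by rewrite UB0 hausdorff_gauge0 adde0; apply: le_hausdorff_gauge => z [].
have := le_trans (mdist_le_diam Ux Uy) (Ud i); rewrite lee_fin => xyd.
by have := lt_le_trans lte (sepAB _ _ Ax By); rewrite ltNge xyd.
Qed.

Let deep (G : set X) (k : nat) : set X :=
  [set x | forall y, ~ G y -> (k.+1%:R^-1 <= mdist x y)%R].

Let deep_sub G k : deep G k `<=` G.
Proof.
move=> x Gx; apply: contrapT => nGx; have := Gx _ nGx.
by rewrite mdistxx leNgt invr_gt0 ltr0Sn.
Qed.

Let deepS G k : deep G k `<=` deep G k.+1.
Proof.
by move=> x Gx y nGy; apply: le_trans (Gx _ nGy); rewrite lef_pV2 ?posrE// ler_nat.
Qed.

Let le_deep G k l : (k <= l)%N -> deep G k `<=` deep G l.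
Proof.
move=> /subnK <-; elim: (l - k)%N => [//|n ih].
by apply: subset_trans ih _; rewrite addSn; exact: deepS.
Qed.

Let deep_open G : open G -> G `<=` \bigcup_k deep G k.
Proof.
move=> oG x Gx; have /nbhs_ballP[e /= e0 eG] : nbhs x G by exact: open_nbhs_nbhs.
exists (Num.truncn e^-1) => // y nGy; rewrite leNgt; apply/negP => xy.
apply/nGy/eG; rewrite ballEmdist/=; apply: lt_trans xy _.
by rewrite invf_plt ?posrE// truncnS_gt.
Qed.

Let deep_sep G k x y : deep G k x -> ~ deep G k.+1 y ->
  (k.+1%:R^-1 - k.+2%:R^-1 <= mdist x y)%R.
Proof.
move=> Gx /existsNP[z /not_implyP[nGz /negP]]; rewrite -ltNge => yz.
rewrite lerBlDr; apply: le_trans (Gx _ nGz) _.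
apply: le_trans (metric_triangle x y z) _; rewrite lerD2l; exact: ltW.
Qed.

Let gap_gt0 k : (0 < k.+1%:R^-1 - k.+2%:R^-1 :> R)%R.
Proof. by rewrite subr_gt0 ltf_pV2 ?posrE// ltr_nat. Qed.

Lemma hausdorff_caratheodory_open (G : set X) : open G ->
  caratheodory_measurable H G.
Proof.
move=> oG; apply: le_caratheodory_measurable => A.
change (H (A `&` G) + H (A `&` ~` G) <= H A).
have [->|Aoo] := eqVneq (H A) +oo; first by rewrite leey.
have Af : H A \is a fin_num by rewrite ge0_fin_numE ?hausdorff_ge0// ltey.
pose D k := A `&` (deep G k.+1 `\` deep G k).
have D_sub k : D k `<=` A `&` deep G k.+1 by move=> x [? []].
have partial b n : \sum_(k < n) H (D (k.*2 + b)%N) <=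
    H (A `&` deep G (n.*2 + b).-1).
  elim: n => [|n ih]; first by rewrite big_ord0 hausdorff_ge0.
  rewrite big_ord_recr/=; case: n ih => [_|n ih].
    rewrite big_ord0 add0e; apply: le_hausdorff; exact: D_sub.
  apply: le_trans (leeD2r _ ih) _.
  rewrite !doubleS !addSn /=; set m := (n.*2 + b)%N.
  apply: le_trans (hausdorff_separated (gap_gt0 m.+1) _) _.
    by move=> x y [_ Gx] [_ [_ Gy]]; exact: deep_sep Gx Gy.
  apply: le_hausdorff => x [[Ax Gx]|/D_sub//]; split=> //.
  exact/deepS/deepS.
have splitD n : \sum_(i < n.*2) H (D i) =
    \sum_(k < n) H (D (k.*2 + 0)%N) + \sum_(k < n) H (D (k.*2 + 1)%N).
  elim: n => [|n ih]; first by rewrite !big_ord0 adde0.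
  by rewrite doubleS !big_ord_recr/= ih addn0 addn1 -!addeA; congr (_ + _);
    rewrite addeCA.
have HDoo : \sum_(0 <= i <oo) H (D i) < +oo.
  apply: (@le_lt_trans _ _ (H A + H A)); last by rewrite -ge0_fin_numE ?adde_ge0 ?hausdorff_ge0// fin_numD Af.
  apply: lime_le; first by apply: is_cvg_nneseries => *; exact: hausdorff_ge0.
  apply: nearW => n; apply: (@le_trans _ _ (\sum_(i < n.*2) H (D i))).
    rewrite big_mkord; apply: (lee_sum_nneg_ord (H \o D) xpredT) => //.
      by move=> *; exact: hausdorff_ge0.
    by rewrite -addnn leq_addr.
  rewrite splitD; apply: leeD; apply: le_trans (partial _ _) _;
    by apply: le_hausdorff => x [].
have tail k : H (A `&` G) + H (A `&` ~` G) <= H A + \sum_(k <= i <oo) H (D i).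
  have AG : H (A `&` G) <= H (A `&` deep G k) + \sum_(k <= i <oo) H (D i).
    apply: (@le_trans _ _ (H ((A `&` deep G k) `|` \bigcup_(i in ~` `I_k) D i))).
      apply: le_hausdorff => x [Ax Gx].
      have [xk|xk] := pselect (deep G k x); [by left|right].
      have [m _ xm] := deep_open oG Gx.
      have ex : exists m, `[< deep G m x >] by exists m; exact/asboolP.
      case: (ex_minnP ex) => -[|n] /asboolP xn nmin.
        by case: xk; apply: le_deep xn.
      have kn : (k <= n)%N.
        by rewrite leqNgt; apply/negP => nk; apply: xk; apply: le_deep xn.
      exists n; first by apply/negP; rewrite -leqNgt.
      split=> //; split=> // /asboolP/nmin; by rewrite ltnn.
    apply: le_trans (outer_measureU2 H _ _) _.
    by rewrite leeD2l// outer_measure_sigma_subadditive_tail.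
  apply: le_trans (leeD2r _ AG) _; rewrite addeAC leeD2r//.
  apply: le_trans (hausdorff_separated (e := k.+1%:R^-1) _ _) _.
  - by rewrite invr_gt0.
  - by move=> x y [_ Gx] [_ Gy]; exact: Gx.
  - by apply: le_hausdorff => x [[]|[]].
have cvgA : H A + \sum_(k <= i <oo) H (D i) @[k --> \oo] --> H A + 0.
  apply: cvgeD; [by rewrite fin_num_adde_defr|exact: cvg_cst|].
  by apply: nneseries_tail_cvg => // *; exact: hausdorff_ge0.
rewrite adde0 in cvgA; rewrite -(cvg_lim _ cvgA)//.
apply: lime_ge; first by apply/cvg_ex; exists (H A).
exact: nearW.
Qed.

Lemma hausdorff_sigma_additive :
  semi_sigma_additive (H : set (borel_space X) -> \bar R).
Proof.
move=> F mF tF mUF.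
have cara (B : set X) : measurable (B : set (borel_space X)) ->
    caratheodory_measurable H B.
  apply: smallest_sub; last exact: hausdorff_caratheodory_open.
  split=> [|B' mB'|B' mB'].
  - exact: caratheodory_measurable_set0.
  - by rewrite setTD; exact: caratheodory_measurable_setC.
  - exact: caratheodory_measurable_bigcup.
apply: (@caratheodory_measure_sigma_additive R X H) => //.
- by move=> i; apply: cara; exact: mF.
- exact: cara.
Qed.

HB.instance Definition _ := isMeasure.Build _ (borel_space X) R
  (H : set (borel_space X) -> \bar R)
  hausdorff0 hausdorff_ge0 hausdorff_sigma_additive.

End hausdorff_outer.

Definition hausdorff_measure (R : realType) (X : pmetricType R) (d : nat) :
    {measure set (borel_space X) -> \bar R} :=
  @hausdorff R X d : set (borel_space X) -> \bar R.

Definition euclidean_norm (R : realType) (n : nat) (x : 'rV[R]_n) : R :=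
  Num.sqrt (\sum_(i < n) x 0 i ^+ 2).

(* R^n with the Euclidean distance; the library's metric structure on 'rV[R]_n
   comes from the maximum norm. *)
Definition euclidean_space (R : realType) (n : nat) : Type := 'rV[R]_n.

Definition unit_sphere (R : realType) (n : nat) : Type :=
  {x : 'rV[R]_n.+1 | euclidean_norm x == 1}.

Section euclidean_norm_theory.
Context {R : realType} {n : nat}.
Implicit Types x y : 'rV[R]_n.

Lemma euclidean_norm_ge0 x : 0 <= euclidean_norm x.
Proof. exact: sqrtr_ge0. Qed.

Lemma sqr_euclidean_norm x : euclidean_norm x ^+ 2 = \sum_(i < n) x 0 i ^+ 2.
Proof. by rewrite sqr_sqrtr// sumr_ge0// => i _; exact: sqr_ge0. Qed.

Lemma euclidean_norm0 : euclidean_norm (0 : 'rV[R]_n) = 0.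
Proof. by rewrite /euclidean_norm big1 ?sqrtr0// => i _; rewrite mxE expr0n. Qed.

Lemma euclidean_norm_eq0 x : euclidean_norm x = 0 -> x = 0.
Proof.
move=> x0; have /eqP : \sum_(i < n) x 0 i ^+ 2 = 0.
  by rewrite -sqr_euclidean_norm x0 expr0n.
rewrite psumr_eq0 => [/allP xi|i _]; last exact: sqr_ge0.
apply/rowP => i; rewrite mxE; apply/eqP.
by rewrite -sqrf_eq0; apply: xi; rewrite mem_index_enum.
Qed.

Lemma euclidean_normN x : euclidean_norm (- x) = euclidean_norm x.
Proof. by congr Num.sqrt; apply: eq_bigr => i _; rewrite mxE sqrrN. Qed.

Lemma euclidean_cauchy_schwarz x y :
  \sum_(i < n) x 0 i * y 0 i <= euclidean_norm x * euclidean_norm y.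
Proof.
set a := euclidean_norm x; set b := euclidean_norm y.
have [a0|a0] := eqVneq a 0.
  rewrite a0 mul0r big1// => i _.
  by rewrite (euclidean_norm_eq0 a0) mxE mul0r.
have [b0|b0] := eqVneq b 0.
  rewrite b0 mulr0 big1// => i _.
  by rewrite (euclidean_norm_eq0 b0) mxE mulr0.
have ab0 : 0 < a * b.
  by rewrite mulr_gt0// lt_neqAle eq_sym ?a0 ?b0 euclidean_norm_ge0.
have : 0 <= \sum_(i < n) (b * x 0 i - a * y 0 i) ^+ 2.
  by rewrite sumr_ge0// => i _; exact: sqr_ge0.
rewrite (eq_bigr (fun i => (b ^+ 2 * x 0 i ^+ 2 + a ^+ 2 * y 0 i ^+ 2)
    - (2 * (a * b)) * (x 0 i * y 0 i))); last by move=> i _; ring.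
rewrite sumrB big_split/= -!mulr_sumr -!sqr_euclidean_norm -/a -/b.
rewrite (_ : b ^+ 2 * a ^+ 2 + a ^+ 2 * b ^+ 2 = (2 * (a * b)) * (a * b)).
  by rewrite -mulrBr pmulr_rge0 ?subr_ge0// mulr_gt0.
by ring.
Qed.

Lemma euclidean_normD x y :
  euclidean_norm (x + y) <= euclidean_norm x + euclidean_norm y.
Proof.
rewrite -(@ler_pXn2r _ 2)// ?nnegrE ?addr_ge0 ?euclidean_norm_ge0//.
rewrite sqrrD !sqr_euclidean_norm.
under eq_bigr do rewrite mxE sqrrD.
rewrite !big_split/= lerD2r lerD2l.
by rewrite mulr2n lerD ?euclidean_cauchy_schwarz.
Qed.

End euclidean_norm_theory.

Section euclidean_metric.
Context (R : realType) (n : nat).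
Implicit Types x y z : 'rV[R]_n.

Let dist x y : R := euclidean_norm (x - y).

Let distxx x : dist x x = 0.
Proof. by rewrite /dist subrr euclidean_norm0. Qed.

Let dist_positivity x y : dist x y = 0 -> x = y.
Proof. by move=> /euclidean_norm_eq0/eqP; rewrite subr_eq0 => /eqP. Qed.

Let dist_sym x y : dist x y = dist y x.
Proof. by rewrite /dist -euclidean_normN opprB. Qed.

Let dist_triangle y x z : dist x z <= dist x y + dist y z.
Proof. by rewrite /dist -(subrKA y); exact: euclidean_normD. Qed.

HB.instance Definition _ := Choice.copy (euclidean_space R n) 'rV[R]_n.
HB.instance Definition _ := isPointed.Build (euclidean_space R n) (0 : 'rV[R]_n).
HB.instance Definition _ := isMetric.Build R (euclidean_space R n)
  distxx dist_positivity dist_sym dist_triangle.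

End euclidean_metric.

Section sphere_metric.
Context (R : realType) (n : nat).
Local Notation S := {x : 'rV[R]_n.+1 | euclidean_norm x == 1}.

Let dist (x y : S) : R :=
  mdist (val x : euclidean_space R n.+1) (val y : euclidean_space R n.+1).

Let distxx x : dist x x = 0. Proof. exact: mdistxx. Qed.

Let dist_positivity x y : dist x y = 0 -> x = y.
Proof. by move=> /mdist_positivity/val_inj. Qed.

Let dist_sym x y : dist x y = dist y x. Proof. exact: metric_sym. Qed.

Let dist_triangle y x z : dist x z <= dist x y + dist y z.
Proof. exact: metric_triangle. Qed.

Lemma euclidean_norm_north_pole :
  euclidean_norm (delta_mx 0 0 : 'rV[R]_n.+1) == 1.
Proof.
rewrite /euclidean_norm (bigD1 0)//= big1 => [|i i0]; last first.
  by rewrite mxE eqxx (negbTE i0) expr0n.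
by rewrite mxE !eqxx expr1n addr0 sqrtr1.
Qed.

HB.instance Definition _ := Choice.copy (unit_sphere R n) S.
HB.instance Definition _ := isPointed.Build (unit_sphere R n)
  (Sub (delta_mx 0 0) euclidean_norm_north_pole : S).
HB.instance Definition _ := isMetric.Build R (unit_sphere R n)
  distxx dist_positivity dist_sym dist_triangle.

End sphere_metric.

(* The Riemannian volume of the sphere is a constant multiple of its
   n-dimensional Hausdorff measure, whose total mass is positive and finite;
   hence the second argument of [mnormalize], which serves for total mass 0 or
   +oo, plays no role. *)
Definition sphere_volume (R : realType) (n : nat) :
    probability (borel_space (unit_sphere R n)) R :=
  mnormalize (hausdorff_measure (unit_sphere R n) n) (\d_ point).

(* Main.v *)
Require Import Defs.
From mathcomp Require Import all_boot all_order all_algebra.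
From mathcomp Require Import all_classical all_reals all_analysis.
From mathcomp Require Import ring lra zify.

Set Implicit Arguments.
Unset Strict Implicit.
Unset Printing Implicit Defensive.

Import Order.TTheory GRing.Theory Num.Theory.
Import numFieldNormedType.Exports.

Local Open Scope classical_set_scope.
Local Open Scope ring_scope.

(** The inclusion of the sphere into [R^(n+1)] is 1-Lipschitz, so it is enough
    that a Borel set [A] of the sphere with diameter at most 1/2 has measure at
    most [1 / (n + 1)], which is below [1 - kappa] for [n] large: the lower limit
    is then at least 1/2, for every [kappa].

    For this bound, fix a point [x] of [A]. For each vector [e_i] of the standard
    basis, the reflection that exchanges [e_i] and [x] maps [A] onto a copy of
    [A] inside the ball of radius 1/2 around [e_i]. The [n + 1] basis vectors are
    at mutual distance [sqrt 2 > 1], so the copies are disjoint; Hausdorff measure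
    being invariant under isometries, [n + 1] times the measure of [A] is at most
    the measure of the sphere ([small_diam_hausdorff]).

    Dividing by the total mass requires the [n]-dimensional Hausdorff measure of
    the sphere to be finite and positive. It is finite
    ([hausdorff_sphere_finite]) because, where a coordinate [x_i] is bounded away
    from 0, the sphere is a Lipschitz graph over the other coordinates, so that
    [O(k^n)] sets of diameter [O(1/k)] cover it. It is positive
    ([hausdorff_sphere_gt0]) because the graph of the upper half-sphere expands
    the distances of a cube of [R^n]: a cover of the sphere induces a cover of
    the cube, which by compactness may be taken finite and made of open cubes, at
    the cost of a constant factor on their sides; counting the points of a fine
    lattice in these cubes bounds the sum of the [n]-th powers of their sides
    from below ([cube_cover]). *)

(** * Diameters and covers *)

Section diameter_theory.
Context {R : realType}.
Local Open Scope ereal_scope.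

Lemma diam_le (X : metricType R) (A : set X) (c : R) : (0 <= c)%R ->
  (forall x y, A x -> A y -> (mdist x y <= c)%R) -> diam A <= c%:E.
Proof.
move=> c0 Ac; rewrite /diam ge_max lee_fin c0/=.
by apply: ge_ereal_sup => _ [[x y] [/= Ax Ay] <-]; rewrite lee_fin Ac.
Qed.

Lemma diam_preimage_le (X Y : metricType R) (f : X -> Y) (A : set Y) :
  (forall x y, mdist x y <= mdist (f x) (f y))%R -> diam (f @^-1` A) <= diam A.
Proof.
move=> fe; rewrite {1}/diam ge_max diam_ge0/=.
apply: ge_ereal_sup => _ [[x y] [/= Ax Ay] <-].
by apply: le_trans (mdist_le_diam Ax Ay); rewrite lee_fin.
Qed.

Lemma lee_expn2r (d : nat) (x y : \bar R) : 0 <= x -> x <= y -> x ^+ d <= y ^+ d.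
Proof.
move=> x0 xy; elim: d => [//|d ih].
by rewrite !expeS lee_pmul// expe_ge0.
Qed.

(** A map that does not decrease distances pulls a cover back to a cover by sets
    of no greater diameter. *)
Lemma hausdorff_preimage_le (X Y : pmetricType R) (d : nat) (f : X -> Y)
    (A : set Y) : (forall x y, mdist x y <= mdist (f x) (f y))%R ->
  hausdorff d (f @^-1` A) <= hausdorff d A.
Proof.
move=> fe; apply: ge_ereal_sup => _ [delta /= d0 <-].
apply: le_trans (hausdorff_content_le_hausdorff _ _ d0).
apply: le_ereal_inf_tmp => _ [U [Ud AU] <-].
apply: (@le_trans _ _ (\sum_(i <oo) hausdorff_gauge d (f @^-1` U i))).
  apply: ereal_inf_lbound; exists (fun i => f @^-1` U i) => //; split.
    by move=> i; apply: le_trans (Ud i); exact: diam_preimage_le.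
  by move=> x /AU[i _ Uix]; exists i.
apply: lee_nneseries => [i _ _|i _]; first exact: hausdorff_gauge_ge0.
rewrite /hausdorff_gauge; case: ifPn => [_|fU0].
  exact: hausdorff_gauge_ge0.
case: ifPn => [/eqP U0|_]; first by rewrite U0 preimage_set0 eqxx in fU0.
by rewrite lee_expn2r ?diam_ge0// diam_preimage_le.
Qed.

(** Finite covers suffice for an upper bound: they are completed by empty sets,
    whose gauge is 0. *)
Lemma hausdorff_le_finite_cover (X : pmetricType R) (d : nat) (A : set X)
    (c : \bar R) :
  (forall delta : R, (0 < delta)%R -> exists s : seq (set X),
    [/\ forall U, U \in s -> diam U <= delta%:E,
        forall x, A x -> exists2 U, U \in s & U x &
        \sum_(U <- s) hausdorff_gauge d U <= c]) ->
  hausdorff d A <= c.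
Proof.
move=> Ac; apply: ge_ereal_sup => _ [delta /= d0 <-].
have [s [sd As sc]] := Ac _ d0.
apply: le_trans sc; apply: ereal_inf_lbound; exists (nth set0 s).
  split=> [i|x /As[U /(nthP set0)[i i_s <-] Ux]]; last by exists i.
  have [i_s|i_s] := ltnP i (size s); first by apply: sd; exact: mem_nth.
  by rewrite nth_default// diam0 lee_fin ltW.
rewrite (nneseries_split _ (size s)); last by move=> *; exact: hausdorff_gauge_ge0.
rewrite add0n eseries0 ?adde0; last first.
  by move=> i i_s _; rewrite nth_default// hausdorff_gauge0.
by rewrite (big_nth set0).
Qed.

End diameter_theory.

(** * Reflections of the Euclidean space *)

Section dot_product.
Context {R : realType} {n : nat}.
Implicit Types x y w : 'rV[R]_n.

(** The standard inner product. *)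
Definition dot x y : R := \sum_(i < n) x 0 i * y 0 i.

Lemma dot_norm x : dot x x = euclidean_norm x ^+ 2.
Proof. by rewrite sqr_euclidean_norm; apply: eq_bigr => i _; rewrite expr2. Qed.

Lemma dotC x y : dot x y = dot y x.
Proof. by apply: eq_bigr => i _; rewrite mulrC. Qed.

Lemma dotBl x y z : dot (x - y) z = dot x z - dot y z.
Proof. by rewrite -sumrB; apply: eq_bigr => i _; rewrite !mxE mulrBl. Qed.

Lemma dotZl a x y : dot (a *: x) y = a * dot x y.
Proof. by rewrite /dot mulr_sumr; apply: eq_bigr => i _; rewrite !mxE mulrA. Qed.

Lemma dot0l x : dot 0 x = 0.
Proof. by rewrite -(scale0r 0) dotZl mul0r. Qed.

Lemma dot_delta x i : dot x (delta_mx 0 i) = x 0 i.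
Proof.
rewrite /dot (bigD1 i)//= big1 => [|j /negbTE ji].
  by rewrite mxE !eqxx mulr1 addr0.
by rewrite mxE ji andbF mulr0.
Qed.

Lemma dot_eq0 x : dot x x = 0 -> x = 0.
Proof.
by rewrite dot_norm => /eqP; rewrite sqrf_eq0 => /eqP /euclidean_norm_eq0.
Qed.

Lemma euclidean_norm_le x (c : R) : 0 <= c ->
  (forall i, `|x 0 i| <= c) -> euclidean_norm x <= n%:R * c.
Proof.
move=> c0 xc; rewrite -(@ler_pXn2r _ 2)// ?nnegrE ?mulr_ge0 ?euclidean_norm_ge0//.
rewrite sqr_euclidean_norm; apply: (@le_trans _ _ (\sum_(i < n) c ^+ 2)).
  by apply: ler_sum => i _; rewrite -real_normK ?num_real// lerXn2r// nnegrE.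
rewrite sumr_const card_ord -[leLHS]mulr_natl exprMn ler_wpM2r ?sqr_ge0//.
by rewrite -natrX ler_nat; case: n {x xc} => [//|m]; rewrite -{1}[m.+1]expn1 leq_pexp2l.
Qed.

Lemma coord_le_euclidean_norm x (i : 'I_n) :
  `|x 0 i| <= euclidean_norm x.
Proof.
rewrite -(@ler_pXn2r _ 2)// ?nnegrE ?euclidean_norm_ge0//.
rewrite sqr_euclidean_norm real_normK ?num_real// (bigD1 i)//= lerDl.
by apply: sumr_ge0 => j _; exact: sqr_ge0.
Qed.

(** The orthogonal reflection in the hyperplane [w^perp]; it is the identity for
    [w = 0]. *)
Definition reflection w x := x - (2 * dot x w / dot w w) *: w.

Lemma reflectionB w x y : reflection w x - reflection w y = reflection w (x - y).
Proof.
rewrite /reflection dotBl mulrBr mulrBl scalerBl !opprB.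
by rewrite addrACA [RHS]addrACA; congr (_ + _); rewrite addrC.
Qed.

Lemma dot_reflection w x : dot (reflection w x) w = - dot x w.
Proof.
rewrite /reflection dotBl dotZl; have [w0|w0] := eqVneq (dot w w) 0.
  by rewrite (dot_eq0 w0) [dot x 0]dotC !dot0l mulr0 subr0 oppr0.
by field.
Qed.

Lemma reflectionK w : involutive (reflection w).
Proof.
move=> x; rewrite {1}/reflection dot_reflection mulrN mulNr scaleNr opprK.
by rewrite /reflection subrK.
Qed.

Lemma reflection_norm w x : euclidean_norm (reflection w x) = euclidean_norm x.
Proof.
apply/eqP; rewrite -(@eqrXn2 _ 2)// ?euclidean_norm_ge0// -!dot_norm.
apply/eqP; set r := reflection w x; set a := 2 * dot x w / dot w w.
have rE y : dot r y = dot x y - a * dot w y.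
  by rewrite /r /reflection dotBl dotZl.
by rewrite rE [dot w r]dotC dot_reflection [dot x r]dotC rE [dot w x]dotC; ring.
Qed.

Lemma reflection_swap x y : euclidean_norm x = euclidean_norm y ->
  reflection (x - y) x = y.
Proof.
move=> xy; have wE : dot (x - y) (x - y) = 2 * dot x (x - y).
  rewrite dotBl [dot x _]dotC [dot y _]dotC !dotBl !dot_norm xy [dot x y]dotC.
  by ring.
rewrite /reflection -wE.
have [w0|w0] := eqVneq (dot (x - y) (x - y)) 0.
  have xy0 := dot_eq0 w0.
  by rewrite xy0 scaler0 subr0; apply/eqP; rewrite -subr_eq0 xy0.
by rewrite divff// scale1r subKr.
Qed.

End dot_product.

(** * Disjoint copies of a set of small diameter *)

Section sphere_symmetry.
Context (R : realType) (n : nat).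
Local Notation S := (unit_sphere R n).
Local Notation H := (hausdorff_measure S n).

Lemma mdist_sphereE (x y : S) : mdist x y = euclidean_norm (sval x - sval y).
Proof. by []. Qed.

(** Any two points of the sphere are exchanged by an isometric involution, the
    reflection in their bisecting hyperplane. *)
Lemma sphere_isometry (u v : S) : exists g : S -> S,
  [/\ involutive g, forall x y, mdist (g x) (g y) = mdist x y & g u = v].
Proof.
have gS (x : S) : euclidean_norm (reflection (sval u - sval v) (sval x)) == 1.
  by rewrite reflection_norm; case: x.
exists (fun x =>
  exist (fun y : 'rV[R]_n.+1 => euclidean_norm y == 1) _ (gS x)); split.
- by move=> x; apply: val_inj; rewrite /= reflectionK.
- by move=> x y; rewrite !mdist_sphereE/= reflectionB reflection_norm.
- apply: val_inj; rewrite /= reflection_swap//.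
  by case: u v {gS} => [u /eqP u1] [v /eqP v1]/=; rewrite u1 v1.
Qed.

Lemma isometry_hausdorff (g : S -> S) (A : set S) : involutive g ->
  (forall x y, mdist (g x) (g y) = mdist x y) ->
  H (g @^-1` A) = H A.
Proof.
move=> gK gd; have le B : (H (g @^-1` B) <= H B)%E.
  by apply: hausdorff_preimage_le => x y; rewrite gd.
apply/eqP; rewrite eq_le le/=.
have {1}-> : A = g @^-1` (g @^-1` A) by apply/funext => x /=; rewrite gK.
exact: le.
Qed.

Lemma delta_norm (i : 'I_n.+1) :
  euclidean_norm (delta_mx 0 i : 'rV[R]_n.+1) == 1.
Proof.
rewrite -(@eqrXn2 _ 2)// ?euclidean_norm_ge0// -dot_norm dot_delta mxE !eqxx.
by rewrite expr1n.
Qed.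

(** The vectors of the standard basis, as points of the sphere. *)
Definition basis_point (i : 'I_n.+1) : S :=
  exist (fun x : 'rV[R]_n.+1 => euclidean_norm x == 1) _ (delta_norm i).

Lemma basis_point_dist i j : i != j ->
  1 < mdist (basis_point i) (basis_point j).
Proof.
move=> ij; rewrite mdist_sphereE/= -(@ltr_pXn2r _ 2)// ?nnegrE ?euclidean_norm_ge0//.
rewrite -dot_norm dotBl [X in X - _]dotC [X in _ - X]dotC !dotBl !dot_delta !mxE !eqxx/=.
have ji : j != i by rewrite eq_sym.
rewrite ?(negbTE ij) ?(negbTE ji).
by rewrite expr1n/=; lra.
Qed.

(** A set of diameter at most 1/2 has an isometric copy around each of the
    [n + 1] basis points, and these copies are disjoint. *)
Lemma small_diam_hausdorff (A : set (borel_space S)) :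
  measurable A -> (diam (A : set S) <= (2^-1)%:E)%E ->
  (n.+1%:R%:E * H A <= H setT)%E.
Proof.
move=> mA Ad.
have [->|/set0P[x Ax]] := eqVneq A set0.
  by rewrite measure0 mule0.
have /choice[g gP] := fun i => sphere_isometry (basis_point i) x.
(* [B i] is the copy of [A] around the basis point of index [i] *)
pose B i := g i @^-1` A.
have mB i : measurable (B i : set (borel_space S)).
  rewrite /B -[X in measurable X]setTI; apply: lipschitz1_measurable => //.
  by move=> a b; have [_ -> _] := gP i.
have tB : trivIset setT B.
  move=> i j _ _ [z [Bi Bj]]; apply/eqP; apply/negPn/negP => /basis_point_dist.
  apply/negP; rewrite -leNgt.
  have near k : B k z -> mdist (basis_point k) z <= 2^-1.
    move=> Bk; have [_ <- gk] := gP k; rewrite gk -lee_fin.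
    exact: le_trans (mdist_le_diam Ax Bk) Ad.
  apply: le_trans (metric_triangle _ z _) _; rewrite [mdist z _]metric_sym.
  by have := near _ Bi; have := near _ Bj; lra.
have -> : (n.+1%:R%:E * H A = \sum_(i < n.+1) H (B i))%E.
  rewrite (eq_bigr (fun=> H A)) => [|i _]; last first.
    by have [? ? _] := gP i; exact: isometry_hausdorff.
  by rewrite sumr_const card_ord mule_natl.
rewrite -measure_bigsetU_ord//; apply: le_measure; rewrite ?inE//.
exact: bigsetU_measurable.
Qed.

End sphere_symmetry.

(** * The sphere has finite Hausdorff measure *)

Section sphere_finite.
Context (R : realType) (n : nat).
Local Notation S := (unit_sphere R n).

Lemma sphere_sum (x : S) : \sum_(i < n.+1) (sval x) 0 i ^+ 2 = 1.
Proof. by case: x => [x /= /eqP x1]; rewrite -sqr_euclidean_norm x1 expr1n. Qed.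

Lemma sphere_coord_le1 (x : S) i : `|sval x 0 i| <= 1.
Proof.
by apply: le_trans (coord_le_euclidean_norm _ _) _; case: x => [x /= /eqP ->].
Qed.

Lemma sphere_big_coord (x : S) : exists i, 1 <= n.+1%:R * (sval x) 0 i ^+ 2.
Proof.
apply: contrapT => /forallNP xlt; have := sphere_sum x.
apply/eqP; rewrite lt_eqF//.
rewrite -(@ltr_pM2l _ n.+1%:R)// mulr1 mulr_sumr.
rewrite -[ltRHS]mulr1n [ltRHS](_ : _ = \sum_(i < n.+1) (1 : R)); last first.
  by rewrite sumr_const card_ord.
apply: ltr_sum => [|i _]; last by rewrite ltNge; apply/negP/xlt.
by apply/hasP; exists ord0; rewrite ?mem_index_enum.
Qed.

(** For [t = (i, s, f)], the part of the sphere where the square of the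
    coordinate [i] is at least [1 / (n + 1)], where the boolean [s] tells whether
    this coordinate is nonnegative, and where each other coordinate is in the
    cell of side [1 / k] numbered by [f], the cells being counted from -1. *)
Definition sphere_cell (k : nat)
    (t : 'I_n.+1 * bool * {ffun 'I_n -> 'I_k.*2.+1}) : set S :=
  [set x : S | [/\ 1 <= n.+1%:R * (sval x) 0 t.1.1 ^+ 2,
    (0 <= (sval x) 0 t.1.1) = t.1.2 &
    forall j, (t.2 j)%:R <= k%:R * ((sval x) 0 (lift t.1.1 j) + 1)
              < (t.2 j).+1%:R]].

Lemma sphere_cell_cover k x : exists t, sphere_cell (k := k) t x.
Proof.
have [i xi] := sphere_big_coord x.
exists (i, (0 <= (sval x) 0 i),
  [ffun j => inord (Num.truncn (k%:R * ((sval x) 0 (lift i j) + 1)))]).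
split => //= j; have := sphere_coord_le1 x (lift i j); rewrite ler_norml => /andP[l1 l2].
set y := k%:R * _.
have y0 : 0 <= y by rewrite mulr_ge0//; lra.
have y2 : y <= k.*2%:R.
  by rewrite /y -muln2 natrM ler_wpM2l//; lra.
rewrite ffunE inordK; first exact: truncn_itv.
by rewrite ltnS -(ler_nat R); apply: le_trans y2; rewrite truncn_le.
Qed.

(** Since the squares of the coordinates add up to 1, the coordinate [i] is a
    Lipschitz function of the others as long as it is bounded away from 0. *)
Lemma sphere_cell_diam k t : (0 < k)%N ->
  (diam (@sphere_cell k t) <= (2 * n.+1%:R ^+ 3 / k%:R)%:E)%E.
Proof.
case: t => [[i s] f] k0; have kR : 0 < k%:R :> R by rewrite ltr0n.
have n0 : 0 < n.+1%:R :> R by rewrite ltr0n.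
apply: diam_le; first by rewrite divr_ge0// mulr_ge0// exprn_ge0.
move=> x y [/= xi xs xf] [/= yi ys yf].
rewrite mdist_sphereE.
have -> : 2 * n.+1%:R ^+ 3 / k%:R = n.+1%:R * (2 * n.+1%:R ^+ 2 / k%:R) :> R by ring.
have other j : `|sval x 0 (lift i j) - sval y 0 (lift i j)| <= k%:R^-1.
  have /andP[x1 x2] := xf j; have /andP[y1 y2] := yf j.
  rewrite -(@ler_pM2l _ k%:R)// divff ?gt_eqF// -{1}(@gtr0_norm _ k%:R)// -normrM.
  rewrite ler_norml; apply/andP; move: x1 x2 y1 y2; rewrite -!natr1 => *; split; nra.
have sqr_other j : `|sval x 0 (lift i j) ^+ 2 - sval y 0 (lift i j) ^+ 2| <=
    2 / k%:R.
  rewrite subr_sqr normrM mulrC ler_pM//.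
  apply: le_trans (ler_normD _ _) _.
  by have := sphere_coord_le1 x (lift i j); have := sphere_coord_le1 y (lift i j); lra.
have sqr_i : `|sval x 0 i ^+ 2 - sval y 0 i ^+ 2| <= n%:R * (2 / k%:R).
  have : \sum_j sval x 0 j ^+ 2 = \sum_j sval y 0 j ^+ 2.
    by rewrite !sphere_sum.
  rewrite !(bigD1_ord i)//= => xy.
  have -> : sval x 0 i ^+ 2 - sval y 0 i ^+ 2 =
      - \sum_(j < n) (sval x 0 (lift i j) ^+ 2 - sval y 0 (lift i j) ^+ 2).
    by rewrite sumrB; lra.
  rewrite normrN; apply: le_trans (ler_norm_sum _ _ _) _.
  apply: (@le_trans _ _ (\sum_(j < n) (2 / k%:R : R))); first exact: ler_sum.
  by rewrite sumr_const card_ord -[leLHS]mulr_natl.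
have main : `|sval x 0 i - sval y 0 i| <= 2 * n.+1%:R ^+ 2 / k%:R.
  (* [|x_i| <= 1] gives [|x_i| >= x_i ^+ 2], which avoids square roots *)
  have xi1 : n.+1%:R^-1 <= `|sval x 0 i|.
    have x1 := sphere_coord_le1 x i.
    rewrite -(@ler_pM2l _ n.+1%:R)// divff ?gt_eqF//; apply: le_trans xi _.
    rewrite ler_wpM2l// -real_normK ?num_real// expr2.
    by rewrite -[leRHS]mulr1 ler_wpM2l.
  have sum_xy : n.+1%:R^-1 <= `|sval x 0 i + sval y 0 i|.
    apply: le_trans xi1 _; have [s1|s0] := boolP s.
      by rewrite !ger0_norm ?addr_ge0 ?xs ?ys// lerDl ys.
    have {}xs : sval x 0 i < 0 by rewrite ltNge xs.
    have {}ys : sval y 0 i < 0 by rewrite ltNge ys.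
    by rewrite !ltr0_norm; lra.
  move: sqr_i; rewrite subr_sqr normrM => sqr_i.
  have : `|sval x 0 i - sval y 0 i| * n.+1%:R^-1 <= n%:R * (2 / k%:R).
    by apply: le_trans sqr_i; rewrite ler_wpM2l.
  rewrite ler_pdivrMr// => /le_trans; apply.
  rewrite [leLHS](_ : _ = (n%:R * n.+1%:R) * (2 / k%:R)); last by ring.
  rewrite [leRHS](_ : _ = (n.+1%:R * n.+1%:R) * (2 / k%:R)); last by ring.
  by rewrite ler_wpM2r ?divr_ge0// ler_wpM2r// ler_nat.
apply: euclidean_norm_le => [|l]; first by rewrite divr_ge0// mulr_ge0// exprn_ge0.
rewrite !mxE; case: (unliftP i l) => [j|] -> //.
apply: le_trans (other j) _; rewrite ler_pdivlMr// mulVf ?gt_eqF//.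
by rewrite -natrX -natrM ler1n muln_gt0 expn_gt0.
Qed.

(** There are [2 (n + 1) (2 k + 1) ^ n] cells. *)
Lemma hausdorff_sphere_finite : (hausdorff n [set: S] < +oo)%E.
Proof.
pose C : R := 2 * n.+1%:R ^+ 3.
have C0 : 0 <= C by rewrite mulr_ge0// exprn_ge0.
apply: (@le_lt_trans _ _ (n.+1.*2%:R * (3 * C) ^+ n)%:E); last by rewrite ltry.
apply: hausdorff_le_finite_cover => delta delta0.
pose k := (Num.truncn (C / delta)).+1.
have kR : 0 < k%:R :> R by rewrite ltr0n.
have Ck : C / k%:R <= delta.
  by rewrite ler_pdivrMr// mulrC -ler_pdivrMr// ltW// truncnS_gt.
exists [seq @sphere_cell k t | t : 'I_n.+1 * bool * {ffun 'I_n -> 'I_k.*2.+1}].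
split.
- move=> _ /mapP[t _ ->]; apply: le_trans (sphere_cell_diam t _) _ => //.
- move=> x _; have [t xt] := sphere_cell_cover k x.
  by exists (@sphere_cell k t) => //; apply: map_f; rewrite mem_enum.
- rewrite big_map big_enum/=.
  apply: (@le_trans _ _ (\sum_(t : 'I_n.+1 * bool * {ffun 'I_n -> 'I_k.*2.+1})
      ((C / k%:R) ^+ n)%:E)%E).
    apply: lee_sum => t _; rewrite /hausdorff_gauge; case: ifP => _.
      by rewrite lee_fin exprn_ge0// divr_ge0.
    by rewrite EFin_expe lee_expn2r ?diam_ge0// sphere_cell_diam.
  rewrite sumEFin lee_fin sumr_const !card_prod card_bool card_ffun !card_ord.
  rewrite -[leLHS]mulr_natl natrM muln2 -mulrA ler_wpM2l// natrX -exprMn.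
  rewrite lerXn2r ?nnegrE ?mulr_ge0 ?divr_ge0//.
  rewrite mulrA ler_pdivrMr// mulrAC ler_wpM2r//.
  by rewrite -natrM ler_nat -muln2 /k; lia.
Qed.

End sphere_finite.

(** * The sphere has positive Hausdorff measure *)

Section lattice.
Context {R : realType}.

(** An open interval of length [L] contains at most [L + 1] integers. *)
Lemma card_nat_itv (N : nat) (c L : R) : 0 <= L ->
  #|[pred i : 'I_N | c < i%:R < c + L]|%:R <= L + 1.
Proof.
move=> L0; set A := [pred i : 'I_N | _].
have [i0 Ai0|A0] := pickP (mem A); last by rewrite eq_card0// addr_ge0.
have [p Ap pmin] := @arg_minnP _ i0 (mem A) val Ai0.
have [q Aq qmax] := @arg_maxnP _ i0 (mem A) val Ai0.
have card_le : (#|A| <= (q - p).+1)%N.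
  rewrite cardE -(size_map val) -[(q - p).+1](size_iota p).
  apply: uniq_leq_size; first by rewrite (map_inj_uniq val_inj) enum_uniq.
  move=> _ /mapP[i + ->]; rewrite mem_enum mem_iota => Ai.
  have := pmin _ Ai; have := qmax _ Ai; rewrite /=; lia.
apply: (@le_trans _ _ (q - p).+1%:R); first by rewrite ler_nat.
rewrite -natr1 lerD2r natrB ?pmin//.
by move: Ap Aq; rewrite !inE => /andP[? ?] /andP[? ?]; lra.
Qed.

(** An open cube of side [2 r] contains at most [(2 r k / a + 1) ^ m] points of
    the lattice of mesh [a / k], where [1 <= r k / a] for a fine lattice. *)
Lemma card_lattice_cube (m k : nat) (a r : R) (x : 'rV[R]_m) :
  0 < a -> (0 < k)%N -> a <= r * k%:R ->
  #|[pred f : {ffun 'I_m -> 'I_k.+1} |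
     [forall j, `|x 0 j - a * (f j)%:R / k%:R| < r]]|%:R
  <= (3 * r * k%:R / a) ^+ m.
Proof.
move=> a0 k0 ark; have kR : 0 < k%:R :> R by rewrite ltr0n.
pose F (j : 'I_m) := [pred i : 'I_k.+1 | `|x 0 j - a * i%:R / k%:R| < r].
rewrite (eq_card (B := family F)); last first.
  by move=> f; rewrite !inE; apply: eq_forallb => j; rewrite ?inE.
have -> : #|family F| = (\prod_(j < m) #|F j|)%N.
  by rewrite card_family foldrE big_map big_enum.
rewrite natr_prod -[m in leRHS]card_ord -prodr_const.
apply: ler_prod => j _; rewrite ler0n/=.
have ra : 1 <= r * k%:R / a by rewrite ler_pdivlMr// mul1r.
rewrite (eq_card (B := [pred i : 'I_k.+1 | (x 0 j - r) * k%:R / a < i%:R <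
  (x 0 j - r) * k%:R / a + 2 * (r * k%:R / a)])).
  by apply: le_trans (card_nat_itv _ _ _) _; lra.
move=> i; rewrite !inE distrC ltr_distl.
rewrite (_ : _ + 2 * _ = (x 0 j + r) * k%:R / a); last by ring.
by rewrite ltr_pdivlMr// ltr_pdivrMr// ltr_pdivrMr// ltr_pdivlMr// [_ * a]mulrC.
Qed.

(** The volume of a cube covered by finitely many open cubes, up to a factor
    [(3 / 2) ^ m]. *)
Lemma cube_cover (m N : nat) (a : R) (x : 'I_N -> 'rV[R]_m) (r : 'I_N -> R) :
  0 < a -> (forall i, 0 < r i) ->
  (forall v : 'rV[R]_m, (forall j, 0 <= v 0 j <= a) ->
    exists i, forall j, `|x i 0 j - v 0 j| < r i) ->
  a ^+ m <= \sum_(i < N) (3 * r i) ^+ m.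
Proof.
move=> a0 r0 cover.
(* the mesh [a / k] is at most each of the radii *)
pose k := (\max_(i < N) (Num.truncn (a / r i)).+1).+1.
have kR : 0 < k%:R :> R by rewrite ltr0n.
have ark i : a <= r i * k%:R.
  rewrite mulrC -ler_pdivrMr// ltW//; apply: lt_le_trans (truncnS_gt _) _.
  by rewrite ler_nat ltnW// ltnS (leq_bigmax i).
pose G i := [pred f : {ffun 'I_m -> 'I_k.+1} |
     [forall j, `|x i 0 j - a * (f j)%:R / k%:R| < r i]].
have card_le : (k.+1 ^ m <= \sum_(i < N) #|G i|)%N.
  rewrite -{1}[k.+1]card_ord -{1}[m]card_ord -card_ffun -sum1_card.
  under [leqRHS]eq_bigr do rewrite -sum1_card big_mkcond/=.
  rewrite exchange_big/=; apply: leq_sum => f _.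
  have [j|i xi] := cover (\row_j (a * (f j)%:R / k%:R)).
    rewrite mxE !mulr_ge0 ?invr_ge0 ?(ltW a0)//= ler_pdivrMr// ler_pM2l// ler_nat.
    by rewrite -ltnS.
  rewrite (bigD1 i)//= inE ifT ?leq_addr//.
  by apply/forallP => j; have := xi j; rewrite mxE.
rewrite -(@ler_pM2r _ ((k%:R / a) ^+ m)) ?exprn_gt0 ?divr_gt0//.
rewrite -exprMn mulrCA divff ?gt_eqF// mulr1 mulr_suml.
apply: (@le_trans _ _ (k.+1 ^ m)%:R).
  by rewrite natrX lerXn2r ?nnegrE// ler_nat.
apply: (@le_trans _ _ (\sum_(i < N) #|G i|%:R)).
  by rewrite -natr_sum ler_nat.
apply: ler_sum => i _; rewrite -exprMn mulrA.
exact: card_lattice_cube.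
Qed.

End lattice.

Section hausdorff_lower_bound.
Context {R : realType}.

(* the vectors with all coordinates between 0 and [a] *)
Local Notation cube m a := [set v : 'rV[R]_m | forall j, `[0, a]%classic (v 0 j)].

(** Compactness of the cube, for a countable cover by closed cubes that are
    enlarged to open ones. *)
Lemma compact_open_cube_cover (m : nat) (a : R) (x : nat -> 'rV[R]_m)
    (r r' : nat -> R) :
  (forall i, 0 < r i < r' i) ->
  (forall v, cube m a v -> exists i, forall j, `|x i 0 j - v 0 j| <= r i) ->
  exists N, forall v, cube m a v ->
    exists i : 'I_N, forall j, `|x i 0 j - v 0 j| < r' i.
Proof.
move=> rr' cover.
have : compact (cube m a).
  by apply: (rV_compact (A := fun=> `[0, a]%classic)) => _; exact: segment_compact.
rewrite compact_cover => /(_ nat setT (fun i => (ball (x i) (r' i))°)).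
case=> [i _|v Kv|D _ KD]; first exact: open_interior.
  have [i vi] := cover _ Kv; exists i => //.
  have /andP[r0 rr] := rr' i.
  apply/nbhs_ballP; exists (r' i - r i); rewrite /= ?subr_gt0// => w [_ vw].
  split; first exact: lt_trans rr.
  move=> i0 j; rewrite !ord1; have := vw 0 j; rewrite /ball/= => vwj.
  rewrite -(subrKA (v 0 j)); apply: le_lt_trans (ler_normD _ _) _.
  by have := vi j; lra.
exists (\max_(i <- finmap.enum_fset D) i).+1 => v /KD[i /= iD /interior_subset[_ vi]].
have iN : (i < (\max_(i <- finmap.enum_fset D) i).+1)%N.
  by rewrite ltnS (@leq_bigmax_seq _ _ xpredT id i).
by exists (Ordinal iN) => j; exact: vi.
Qed.

(** A metric space that contains an expanded copy of a cube has positive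
    Hausdorff measure in the dimension of the cube; the distances in the cube are
    those of the maximum norm. *)
Lemma hausdorff_gt0 (X : pmetricType R) (m : nat) (a : R)
    (phi : 'rV[R]_m.+1 -> X) : 0 < a <= 1 ->
  (forall v w, cube m.+1 a v -> cube m.+1 a w ->
    forall j, `|v 0 j - w 0 j| <= mdist (phi v) (phi w)) ->
  (0 < hausdorff m.+1 [set: X])%E.
Proof.
move=> /andP[a0 a1] phie.
(* 6 is the factor 3 of [cube_cover] times the factor 2 between the radii
   [s i] and [2 * s i] below *)
pose c : R := (a / 6) ^+ m.+1 / 2.
have c0 : 0 < c by rewrite divr_gt0// exprn_gt0// divr_gt0.
have c1 : c <= 1.
  rewrite ler_pdivrMr// mul1r; apply: (@le_trans _ _ 1); last by rewrite ler1n.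
  by rewrite exprn_ile1//; [rewrite divr_ge0// ltW|rewrite ler_pdivrMr//; lra].
apply: (@lt_le_trans _ _ c%:E) => //.
apply: le_trans (hausdorff_content_le_hausdorff _ _ ltr01).
apply: le_ereal_inf_tmp => _ [U [Ud XU] <-].
pose d i : R := fine (diam (U i)).
have dE i : diam (U i) = (d i)%:E.
  by rewrite fineK// ge0_fin_numE ?diam_ge0//; apply: le_lt_trans (Ud i) _; rewrite ltry.
have d0 i : 0 <= d i by rewrite -lee_fin -dE diam_ge0.
pose t i : R := c / 2 ^+ i.+1.
have t0 i : 0 < t i by rewrite divr_gt0// exprn_gt0.
have t1 i : t i <= 1.
  rewrite ler_pdivrMr ?exprn_gt0// mul1r; apply: le_trans c1 _.
  by rewrite -natrX ler1n expn_gt0.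
(* [P i] lies in the cube of radius [s i] around any of its points; if it is
   empty, the cube around the default centre 0 is a harmless addition to the
   cover *)
pose P i := [set v : 'rV[R]_m.+1 | cube m.+1 a v /\ U i (phi v)].
pose s i := Num.max (d i) (t i).
have s0 i : 0 < s i by rewrite lt_max t0 orbT.
have [|v Kv|N cover] := @compact_open_cube_cover m.+1 a (fun i => xget 0 (P i))
    s (fun i => 2 * s i).
- by move=> i; rewrite s0/=; have := s0 i; lra.
- have [i _ Ui] := XU (phi v) I; exists i => j.
  have Pv : P i v by [].
  have [Kx Ux] : P i (xget 0 (P i)) by apply: xgetPex; exists v.
  apply: le_trans (phie _ _ Kx Kv j) _; rewrite le_max; apply/orP; left.
  by rewrite -lee_fin -dE mdist_le_diam.
have := cube_cover (x := fun i : 'I_N => xget 0 (P i))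
  (r := fun i : 'I_N => 2 * s i) a0 _ cover.
move=> /(_ (fun i => mulr_gt0 (ltr0Sn _ 1) (s0 i))) vol.
have {}vol : 2 * c <= \sum_(i < N) s i ^+ m.+1.
  rewrite /c mulrCA divff// mulr1 expr_div_n ler_pdivrMr ?exprn_gt0// mulr_suml.
  apply: le_trans vol _; apply: ler_sum => i _.
  by rewrite -exprMn mulrA mulrC -natrM.
(* [s i ^+ m.+1 <= d i ^+ m.+1 + t i], and the [t i] add up to at most [c] *)
have sum_t n : \sum_(i < n) t i = c - c / 2 ^+ n.
  elim: n => [|n ih]; first by rewrite big_ord0 expr0 divr1 subrr.
  rewrite big_ord_recr/= ih /t exprS.
  have : 2 ^+ n != 0 :> R by rewrite expf_neq0.
  by move=> ?; field.
have {vol} : c <= \sum_(i < N) d i ^+ m.+1.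
  have : \sum_(i < N) s i ^+ m.+1 <= \sum_(i < N) (d i ^+ m.+1 + t i).
    apply: ler_sum => i _; rewrite /s; case: (leP (d i) (t i)) => [dt|td].
      apply: (@le_trans _ _ (t i)); last by rewrite lerDr exprn_ge0.
      by rewrite exprS; apply: ler_piMr; [exact: ltW|apply: exprn_ile1; rewrite ?t1 ?(ltW (t0 i))].
    by rewrite lerDl ltW.
  rewrite big_split/= sum_t; have : 0 <= c / 2 ^+ N by rewrite divr_ge0 ?exprn_ge0// ltW.
  by lra.
rewrite -lee_fin => /le_trans; apply.
apply: (@le_trans _ _ (\sum_(0 <= i < N) hausdorff_gauge m.+1 (U i))%E); last first.
  by apply: nneseries_lim_ge => *; exact: hausdorff_gauge_ge0.
rewrite big_mkord -sumEFin; apply: lee_sum => i _.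
rewrite EFin_expe -dE /hausdorff_gauge; case: ifP => // /eqP ->.
by rewrite diam0 expeS mul0e.
Qed.

Lemma hausdorff_sphere_gt0 (n : nat) : (0 < n)%N ->
  (0 < hausdorff n [set: unit_sphere R n])%E.
Proof.
case: n => [//|m] _.
(* side [1 / n], for which the cube lies in the unit ball *)
pose a : R := m.+1%:R^-1.
have a01 : 0 < a <= 1 by rewrite invr_gt0 ltr0n/= invf_le1 ?ltr0n// ler1n.
(* the graph of the upper half-sphere over the cube *)
have /choice[phi phiP] (v : 'rV[R]_m.+1) : exists p : unit_sphere R m.+1,
    cube m.+1 a v -> forall j, sval p 0 (lift ord0 j) = v 0 j.
  have [Kv|nKv] := pselect (cube m.+1 a v); last by exists point => /nKv.
  have v1 : \sum_j v 0 j ^+ 2 <= 1.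
    apply: (@le_trans _ _ (\sum_(j < m.+1) a)).
      apply: ler_sum => j _; have := Kv j; rewrite /= in_itv/= => /andP[v0 va].
      by case/andP: a01 => ? ?; nra.
    by rewrite sumr_const card_ord -[leLHS]mulr_natl divff.
  pose x : 'rV[R]_m.+2 := \row_i
    (if unlift ord0 i is Some j then v 0 j else Num.sqrt (1 - \sum_j v 0 j ^+ 2)).
  have x_lift j : x 0 (lift ord0 j) = v 0 j by rewrite mxE liftK.
  have x1 : euclidean_norm x == 1.
    rewrite /euclidean_norm big_ord_recl.
    under eq_bigr do rewrite x_lift.
    by rewrite mxE unlift_none sqr_sqrtr ?subr_ge0// subrK sqrtr1.
  by exists (exist (fun y : 'rV[R]_m.+2 => euclidean_norm y == 1) _ x1) => _ j /=.
apply: (hausdorff_gt0 (phi := phi) a01) => v w Kv Kw j.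
rewrite mdist_sphereE -(phiP _ Kv) -(phiP _ Kw).
have := coord_le_euclidean_norm (sval (phi v) - sval (phi w)) (lift ord0 j).
by rewrite !mxE.
Qed.

End hausdorff_lower_bound.

(** * The normalized volume and the observable diameter *)

Section sphere_volume_theory.
Context (R : realType) (n : nat).
Local Notation S := (unit_sphere R n).

Lemma sphere_volume_small_diam (A : set (borel_space S)) : (0 < n)%N ->
  measurable A -> (diam (A : set S) <= (2^-1)%:E)%E ->
  (sphere_volume R n A <= (n.+1%:R^-1)%:E)%E.
Proof.
move=> n0 mA Ad; set H := hausdorff_measure S n.
have H0 : (0 < H setT)%E by exact: hausdorff_sphere_gt0.
have Hoo : (H setT < +oo)%E by exact: hausdorff_sphere_finite.
have HE : H setT = (fine (H setT))%:E by rewrite fineK// ge0_fin_numE// ltW.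
have h0 : 0 < fine (H setT) by rewrite -lte_fin -HE.
have -> : sphere_volume R n A = (H A * (fine (H setT))^-1%:E)%E.
  by rewrite /sphere_volume/= /mnormalize (gt_eqF H0) (lt_eqF Hoo).
have := small_diam_hausdorff mA Ad; rewrite -/H [leRHS]HE.
rewrite lee_pdivrMr// -EFinM -lee_pdivlMl// => /le_trans; apply.
Qed.

End sphere_volume_theory.

Lemma limn_einf_ge (R : realType) (u : (\bar R)^nat) (c : \bar R) :
  (\forall k \near \oo, c <= u k)%E -> (c <= limn_einf u)%E.
Proof.
move=> [N _ cu]; rewrite limn_einf_lim; apply: lime_ge.
  exact: is_cvg_einfs.
near=> k; apply: le_ereal_inf_tmp => _ [l /= kl <-]; apply: cu => /=.
by apply: leq_trans kl; near: k; exists N.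
Unshelve. all: by end_near. Qed.

Theorem corollary1p7 (R : realType) (kappa : R)
    (kappa_gt0 : 0 < kappa) (kappa_lt1 : kappa < 1) :
  (0 < limn_einf (fun n : nat =>
    observable_diam (sphere_volume R n) (euclidean_space R n.+1) kappa))%E.
Proof.
apply: (@lt_le_trans _ _ (2^-1 : R)%:E); first by rewrite lte_fin invr_gt0.
apply: limn_einf_ge; near=> n.
have n0 : (0 < n)%N by near: n; exists 1%N.
have n1 : (n.+1%:R^-1 < 1 - kappa)%R.
  rewrite -[ltRHS]invrK ltf_pV2 ?posrE ?invr_gt0 ?subr_gt0//.
  apply: lt_le_trans (truncnS_gt _) _; rewrite ler_nat.
  by near: n; exists (Num.truncn (1 - kappa)^-1).
pose f : unit_sphere R n -> euclidean_space R n.+1 := fun x => sval x.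
have f1 : lipschitz1 f by [].
apply: (@le_trans _ _ (partial_diam (pushforward (sphere_volume R n)
    (f : borel_space _ -> borel_space _))
    (sphere_volume R n [set: borel_space (unit_sphere R n)] - kappa%:E))); last first.
  by apply: ereal_sup_ubound; exists f.
apply: le_ereal_inf_tmp => _ [Y [mY Yk] <-].
rewrite leNgt; apply/negP => Yd.
pose A : set (borel_space (unit_sphere R n)) := f @^-1` Y.
have mA : measurable A.
  by rewrite -[X in measurable X]setTI; exact: lipschitz1_measurable.
have Ad : (diam (A : set (unit_sphere R n)) <= (2^-1)%:E)%E.
  by apply: le_trans (ltW Yd); exact: diam_preimage_le.
have := le_trans Yk (sphere_volume_small_diam n0 mA Ad).
by rewrite probability_setT -EFinB lee_fin leNgt n1.
Unshelve. all: by end_near. Qed.
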